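(* Let $C\subset\mathbf{L}^3$ be the hyperbolic catenoid of axis $(1,0,0)$. For $t\in\mathbb{R}$, the dual surface $P_t(C)^\sharp$ of the image of $C$ by the parabolic rotation $P_t$ about $(1,0,1)$ is a Goursat transformation of a Bonnet minimal surface of $\mathbf{E}^3$.
   Context: $\mathbf{E}^3$ and $\mathbf{L}^3$ denote $\mathbb{R}^3$ with the metric $dx^2+dy^2+\epsilon\,dz^2$, with $\epsilon=1$ and $\epsilon=-1$ respectively. A (conformal) minimal surface of $\mathbf{E}^3$ ($\epsilon=1$) or maximal surface of $\mathbf{L}^3$ ($\epsilon=-1$) is given on a simply-connected domain $\Omega\subset\mathbb{C}$ by $X(z)=X(z_0)+\Re\int_{z_0}^z\phi(w)\,dw$, where the isotropic curve $\phi=2\,\partial X/\partial z:\Omega\to\mathbb{C}^3$ is holomorphic, $\phi_1^2+\phi_2^2+\epsilon\phi_3^2=0$ and $|\phi_1|^2+|\phi_2|^2+\epsilon|\phi_3|^2\not\equiv 0$ (the induced metric may degenerate at some points). Its Weierstrass representation is $(g,\omega)$ with $g=\phi_3/(\phi_1-i\phi_2)$, $\omega=(\phi_1-i\phi_2)dz$, so that $\phi\,dz=\left(\tfrac12(1-\epsilon g^2)\omega,\tfrac i2(1+\epsilon g^2)\omega,g\omega\right)$. Dual surface: if $M$ is maximal in $\mathbf{L}^3$ with isotropic curve $\psi$, then $M^\sharp$ is the minimal surface of $\mathbf{E}^3$ with isotropic curve $(i\psi_1,i\psi_2,\psi_3)$, defined up to translations. Surfaces of $\mathbf{E}^3$ are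 considered up to reparametrization, orientation-preserving isometries and dilations of $\mathbf{E}^3$. The hyperbolic catenoid $C$ of axis $(1,0,0)$ is the maximal surface with $g(z)=i\frac{e^z-1}{e^z+1}$, $\omega=-i\frac{(e^z+1)^2}{2e^z}dz$ on $\mathbb{C}$. The parabolic rotations about $(1,0,1)$ are $$P_t=\begin{pmatrix}1-\frac{t^2}{2}&t&\frac{t^2}{2}\\-t&1&t\\-\frac{t^2}{2}&t&1+\frac{t^2}{2}\end{pmatrix}.$$ The Bonnet minimal surfaces of $\mathbf{E}^3$ are, up to congruences and dilations, the surfaces $\mathcal{B}(\lambda)$, $\lambda\in(0,\infty)$, with Weierstrass representation $g(z)=e^z+\lambda$, $\omega=e^{-z}dz$ on $\mathbb{C}$. A Goursat transformation of a minimal surface of $\mathbf{E}^3$ with isotropic curve $\phi$ is the minimal surface with isotropic curve $A\phi$, where $A\in O(3,\mathbb{C})$; in terms of Weierstrass data, $(g,\omega)$ changes into $(T(g),\omega/T'(g))$ for a Möbius transformation $T$ of $\mathbb{C}\cup\{\infty\}$. *)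

(* Defs.v *)
From HB Require Import structures.
From mathcomp Require Import all_boot all_order all_algebra complex.
From mathcomp Require Import all_classical all_reals all_analysis.

Set Implicit Arguments.
Unset Strict Implicit.
Unset Printing Implicit Defensive.

Import Order.TTheory GRing.Theory Num.Theory.
Import numFieldNormedType.Exports.

Local Open Scope classical_set_scope.
Local Open Scope ring_scope.
Local Open Scope complex_scope.

(* R[i] packed as a numClosedFieldType: this gives it the topology and the
   normed-module-over-itself structure attached to a numFieldType, so that
   [derivable f z 1] for f : Cplx R -> Cplx R is complex differentiability. *)
Definition Cplx (R : realType) : numClosedFieldType := R[i].

Section Surfaces.
Variable R : realType.
Local Notation C := (Cplx R).
Implicit Types (Omega : set C) (X Y Z : C -> 'cV[R]_3).

Definition cexp (z : C) : C :=
  (expR (complex.Re z) * cos (complex.Im z))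
    +i* (expR (complex.Re z) * sin (complex.Im z)).

Definition col3 (K : Type) (a b c : K) : 'cV[K]_3 :=
  \col_(i < 3) nth a [:: a; b; c] i.

Definition diag3 (K : pzRingType) (a b c : K) : 'M[K]_3 :=
  diag_mx (col3 a b c)^T.

Definition holomorphic Omega (f : C -> C) : Prop :=
  forall z, Omega z -> derivable f z 1.

(* Every loop in Omega is contracted in Omega by a homotopy H relative to its
   base point; the first variable of H is the homotopy parameter. *)
Definition loops_contractible Omega : Prop :=
  forall gamma : R -> C,
    {within `[0, 1], continuous gamma} ->
    gamma @` `[0, 1] `<=` Omega ->
    gamma 0 = gamma 1 ->
    exists H : R * R -> C,
      [/\ {within `[0, 1] `*` `[0, 1], continuous H},
          H @` (`[0, 1] `*` `[0, 1]) `<=` Omega,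
          forall s : R, 0 <= s <= 1 -> H (0, s) = gamma s,
          forall s : R, 0 <= s <= 1 -> H (1, s) = gamma 0 &
          forall u : R, 0 <= u <= 1 -> H (u, 0) = gamma 0 /\ H (u, 1) = gamma 0].

Definition simply_connected_domain Omega : Prop :=
  [/\ open Omega, Omega !=set0, connected Omega & loops_contractible Omega].

Definition slice_re X (z : C) (j : 'I_3) (s : R) : R :=
  X (s +i* complex.Im z) j 0.
Definition slice_im X (z : C) (j : 'I_3) (s : R) : R :=
  X (complex.Re z +i* s) j 0.

(* phi = 2 dX/dz = dX/dx - i dX/dy *)
Definition isotropic_curve X (z : C) : 'cV[C]_3 :=
  \col_(j < 3) (derive1 (slice_re X z j) (complex.Re z)
                +i* - derive1 (slice_im X z j) (complex.Im z)).

(* X is, on Omega, a conformal minimal surface of E^3 (eps = 1) or a maximal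
   surface of L^3 (eps = -1).  Existence of the partial derivatives together
   with holomorphy of phi = 2 dX/dz is X(z) = X(z0) + Re int_{z0}^z phi. *)
Definition conformal_surface (eps : R) Omega X : Prop :=
  let phi := isotropic_curve X in
  [/\ simply_connected_domain Omega,
      forall z, Omega z -> forall j,
        derivable (slice_re X z j) (complex.Re z) 1 /\
        derivable (slice_im X z j) (complex.Im z) 1,
      forall j, holomorphic Omega (fun z => phi z j 0),
      forall z, Omega z ->
        phi z 0 0 ^+ 2 + phi z 1 0 ^+ 2 + eps%:C * phi z 2 0 ^+ 2 = 0 &
      exists2 z, Omega z &
        `|phi z 0 0| ^+ 2 + `|phi z 1 0| ^+ 2
          + eps%:C * `|phi z 2 0| ^+ 2 != 0].

Definition minimal_surface := conformal_surface 1.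
Definition maximal_surface := conformal_surface (-1).

(* (g, omega) with omega = w dz.  The Gauss map g is meromorphic: its values
   as a total function are irrelevant where w vanishes. *)
Definition weierstrass_representation Omega X (g w : C -> C) : Prop :=
  let phi := isotropic_curve X in
  forall z, Omega z ->
    w z = phi z 0 0 - 'i * phi z 1 0 /\
    (w z != 0 -> g z = phi z 2 0 / w z).

(* Equality of surfaces of E^3 up to conformal reparametrization h,
   orientation-preserving isometry x |-> Q x + b and dilation of ratio k. *)
Definition similar_surfaces Omega X Omega' X' : Prop :=
  exists (h : C -> C) (k : R) (Q : 'M[R]_3) (b : 'cV[R]_3),
    [/\ set_bij Omega' Omega h, holomorphic Omega' h, 0 < k,
        Q *m Q^T = 1%:M /\ \det Q = 1 &
        forall z, Omega' z -> X' z = k *: (Q *m X (h z)) + b].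

(* Y is a representative (they differ by translations) of the dual M^# of M. *)
Definition dual_surface Omega M Y : Prop :=
  [/\ maximal_surface Omega M, minimal_surface Omega Y &
      forall z, Omega z ->
        isotropic_curve Y z = diag3 'i 'i 1 *m isotropic_curve M z].

Definition goursat_transformation Omega Z Y : Prop :=
  [/\ minimal_surface Omega Z, minimal_surface Omega Y &
      exists A : 'M[C]_3, A *m A^T = 1%:M /\
        forall z, Omega z -> isotropic_curve Y z = A *m isotropic_curve Z z].

Definition hyperbolic_catenoid X : Prop :=
  maximal_surface setT X /\
  weierstrass_representation setT X
    (fun z => 'i * ((cexp z - 1) / (cexp z + 1)))
    (fun z => - 'i * ((cexp z + 1) ^+ 2 / (2 * cexp z))).

Definition parabolic_rotation (t : R) : 'M[R]_3 :=
  \matrix_(i < 3, j < 3)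
    nth 0 (nth [::]
      [:: [:: 1 - t ^+ 2 / 2;  t;  t ^+ 2 / 2     ];
          [:: - t;             1;  t              ];
          [:: - (t ^+ 2 / 2);  t;  1 + t ^+ 2 / 2 ]] i) j.

Definition bonnet_model (lambda : R) Z : Prop :=
  minimal_surface setT Z /\
  weierstrass_representation setT Z
    (fun z => cexp z + lambda%:C) (fun z => cexp (- z)).

Definition bonnet_surface Omega Z : Prop :=
  minimal_surface Omega Z /\
  exists (lambda : R) B,
    [/\ 0 < lambda, bonnet_model lambda B & similar_surfaces setT B Omega Z].

(* Both "Bonnet surface" and "Goursat transformation of" are taken up to the
   identification of surfaces of E^3 given by similar_surfaces. *)
Definition goursat_of_bonnet Omega Y : Prop :=
  exists Omega' Z Y',
    [/\ bonnet_surface Omega' Z, goursat_transformation Omega' Z Y' &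
        similar_surfaces Omega' Y' Omega Y].

End Surfaces.

(* Main.v *)
(** Write [c z = (-i, cosh z, sinh z)] for the isotropic curve of the catenoid.
    That of [P_t(C)^#] is [D P_t c] with [D = diag(i, i, 1)], and since
    [D^2 = - diag(1, 1, -1)], the map [D] carries the complexified Lorentz form
    to minus the Euclidean one.  The curve of the Bonnet surface [B(1)] is
    [A0^T D c] for an explicit complex orthogonal matrix [A0], so
    [D P_t D^-1 A0], which is orthogonal because [P_t] is a Lorentz isometry,
    carries it to the curve of [P_t(C)^#], without any reparametrization. *)

Require Import Defs.
From mathcomp Require Import all_boot all_order all_algebra complex.
From mathcomp Require Import all_classical all_reals all_analysis ring lra.

Set Implicit Arguments.
Unset Strict Implicit.
Unset Printing Implicit Defensive.

Import Order.TTheory GRing.Theory Num.Theory.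
Import numFieldNormedType.Exports.
Local Open Scope classical_set_scope.
(* Opened before [ring_scope], so that ['i] remains [Num.imaginary]. *)
Local Open Scope complex_scope.
Local Open Scope ring_scope.

(** * Derivatives as remainder estimates; vectors of length three *)

(** This division-free form holds over both [R] and [Cplx R] and allows [h = 0], so complex
    remainders can be compared directly with real ones. *)
Lemma is_derive1P (K : numFieldType) (f : K -> K) (x d : K) :
  is_derive x 1 f d <->
  forall e : K, 0 < e -> exists2 r : K, 0 < r &
    forall h, `|h| < r -> `|f (h + x) - f x - d * h| <= e * `|h|.
Proof.
split=> [[df dfE] e e0|fd].
  move/cvgr_dist_lt: df => /(_ e e0).
  rewrite -[lim _]/('D_1 f x) dfE => -[r /= r0 hr].
  exists r => // h hlt; have [->|h0] := eqVneq h 0.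
    by rewrite add0r subrr mulr0 subr0 normr0 mulr0.
  have := hr h; rewrite /= sub0r normrN => /(_ hlt h0).
  rewrite -[h *: 1]/(h * 1) mulr1 -[_ *: _]/(h^-1 * _) => /ltW le_e.
  have -> : f (h + x) - f x - d * h = - (d - h^-1 * (f (h + x) - f x)) * h.
    by field.
  by rewrite normrM normrN ler_wpM2r.
have cv : h^-1 *: ((f \o shift x) (h *: 1) - f x) @[h --> 0^'] --> d.
  apply/cvgrPdist_le => e e0; have [r r0 hr] := fd e e0; exists r => //.
  move=> h /=; rewrite sub0r normrN => hlt h0.
  have := hr h hlt; rewrite -[h *: 1]/(h * 1) mulr1 -[_ *: _]/(h^-1 * _) => le_e.
  have -> : d - h^-1 * (f (h + x) - f x) = - (f (h + x) - f x - d * h) / h.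
    by field.
  by rewrite normrM normrN normfV ler_pdivrMr ?normr_gt0.
split; first by apply/cvg_ex; exists d.
exact: cvg_lim cv.
Qed.

Lemma ord3_ind (P : 'I_3 -> Prop) : P 0 -> P 1 -> P 2 -> forall i, P i.
Proof.
by move=> P0 P1 P2 [[|[|[|//]]] i]; [move: P0|move: P1|move: P2];
  congr P; exact/val_inj.
Qed.

Lemma sum_ord3 (V : nmodType) (F : 'I_3 -> V) : \sum_i F i = F 0 + F 1 + F 2.
Proof.
rewrite !big_ord_recr big_ord0 /= add0r.
by congr (F _ + F _ + F _); exact/val_inj.
Qed.

Lemma is_derive_mulmx (K : numFieldType) m n (M : 'M[K]_(m, n))
    (F : K -> 'cV[K]_n) (dF : 'cV[K]_n) (x : K) :
  (forall k, is_derive x 1 (fun y => F y k 0) (dF k 0)) ->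
  forall j, is_derive x 1 (fun y => (M *m F y) j 0) ((M *m dF) j 0).
Proof.
move=> dF_ j; have := is_derive_sum (fun k => is_deriveZ (M j k) (dF_ k)).
rewrite mxE; congr is_derive.
by apply/funext => y; rewrite mxE fct_sumE.
Qed.

Definition lorentz_mx (K : pzRingType) : 'M[K]_3 := diag3 1 1 (-1).
Local Notation J := lorentz_mx.

Section ConformalSurfaces.
Variable R : realType.
Local Notation C := (Cplx R).
Implicit Types (z : C) (X : C -> 'cV[R]_3) (M : 'M[C]_3).

(** * Real slices of complex differentiable functions *)

Lemma normC_real (a : R) : `|a%:C : C| = (`|a|)%:C.
Proof. by rewrite normc_def /= expr0n addr0 sqrtr_sqr. Qed.

Lemma normC_le (a b : R) : `|a +i* b : C| <= (`|a| + `|b|)%:C.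
Proof.
have -> : (a +i* b : C) = a%:C + 'i * b%:C by rewrite [LHS]complexE.
by rewrite (le_trans (ler_normD _ _))// normrM normCi mul1r !normC_real rmorphD.
Qed.

Lemma is_derive_re_slice (f : C -> C) (z d : C) : is_derive z 1 f d ->
  is_derive (complex.Re z) 1
    (fun s : R => complex.Re (f (s +i* complex.Im z))) (complex.Re d).
Proof.
case: z => x y /is_derive1P fd; apply/is_derive1P => e e0 /=.
(* Positive elements of [Cplx R] are real, so the imaginary part [r'] of the radius vanishes. *)
have [|[r r'] /=] := fd e%:C; first by rewrite ltcR.
rewrite ltcE /= => /andP[/eqP -> r0] hr; exists r => // h hlt.
have := hr h%:C; rewrite normC_real ltcR -rmorphM => /(_ hlt).
have -> : (h%:C + (x +i* y) : C) = (h + x) +i* y.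
  by apply/eqP; rewrite eq_complex /= add0r !eqxx.
move/(le_trans (normc_ge_Re _)); rewrite lecR; congr (`|_| <= _).
by rewrite !raddfB /=; case: d {fd hr} => d d' /=; rewrite mulr0 subr0.
Qed.

(** The complex increment is now ['i * h], and [Re (i d) = - Im d]. *)
Lemma is_derive_im_slice (f : C -> C) (z d : C) : is_derive z 1 f d ->
  is_derive (complex.Im z) 1
    (fun s : R => complex.Re (f (complex.Re z +i* s))) (- complex.Im d).
Proof.
case: z => x y /is_derive1P fd; apply/is_derive1P => e e0 /=.
have [|[r r'] /=] := fd e%:C; first by rewrite ltcR.
rewrite ltcE /= => /andP[/eqP -> r0] hr; exists r => // h hlt.
have := hr ('i * h%:C); rewrite normrM normCi mul1r normC_real ltcR -rmorphM.
move=> /(_ hlt).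
have -> : ('i * h%:C + (x +i* y) : C) = x +i* (h + y).
  by apply/eqP; rewrite eq_complex /=; apply/andP; split; apply/eqP; ring.
move/(le_trans (normc_ge_Re _)); rewrite lecR; congr (`|_| <= _).
by rewrite !raddfB /=; case: d {fd hr} => d d' /=; ring.
Qed.

(** * The complex exponential *)

Lemma cexp0 : cexp 0 = 1 :> C.
Proof. by rewrite /cexp /= expR0 cos0 sin0 mulr1 mulr0. Qed.

Lemma cexpD (z w : C) : cexp (z + w) = cexp z * cexp w.
Proof.
case: z w => [a b] [c d]; apply/eqP; rewrite /cexp eq_complex /=.
by rewrite expRD cosD sinD; apply/andP; split; apply/eqP; ring.
Qed.

Lemma cexpxNx (z : C) : cexp z * cexp (- z) = 1.
Proof. by rewrite -cexpD subrr cexp0. Qed.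

(** The real and imaginary parts of the remainder combine the first-order remainders of [expR],
    [cos] and [sin] at [0] with the second-order term [y * (expR x - 1)]. *)
Lemma cexp_approx0 (e : R) : 0 < e -> exists2 r : R, 0 < r &
  forall h : C, `|h| < r%:C -> `|cexp h - 1 - h| <= e%:C * `|h|.
Proof.
(* With [s] the modulus of [h], the four error terms are at most 1, 3, 3 and 2 times [e1 * s],
   whence the 9; the cap at 1 serves to get [expR x <= 3]. *)
move=> e0; pose e1 := Num.min (e / 9) 1.
have e10 : 0 < e1 by rewrite lt_min ltr01 andbT divr_gt0.
have e1e : 9 * e1 <= e.
  by have := lexx e1; rewrite {2}/e1 le_min => /andP[]; lra.
have e11 : e1 <= 1 by rewrite ge_min lexx orbT.
clearbody e1.
have [r1 r10 h1] := (is_derive1P _ _ _).1 (is_derive_expR 0) _ e10.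
have [r2 r20 h2] := (is_derive1P _ _ _).1 (is_derive_cos 0) _ e10.
have [r3 r30 h3] := (is_derive1P _ _ _).1 (is_derive_sin 0) _ e10.
exists (Num.min e1 (Num.min r1 (Num.min r2 r3))).
  by rewrite !lt_min e10 r10 r20.
move=> [x y]; rewrite normc_def ltcR !lt_min /=.
set s := Num.sqrt _ => /and4P[se1 s1 s2 s3].
have xs : `|x| <= s by rewrite -sqrtr_sqr ler_wsqrtr// lerDl sqr_ge0.
have ys : `|y| <= s by rewrite -sqrtr_sqr ler_wsqrtr// lerDr sqr_ge0.
have := h1 x (le_lt_trans xs s1); have := h2 y (le_lt_trans ys s2).
have := h3 y (le_lt_trans ys s3).
rewrite !addr0 expR0 cos0 sin0 oppr0 mul0r !mul1r !(subr0, addr0) => hs hc he.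
have -> : (cexp (x +i* y) - 1 - (x +i* y) : C) =
    (expR x - 1 - x + expR x * (cos y - 1))
      +i* (expR x * (sin y - y) + y * (expR x - 1)).
  by apply/eqP; rewrite eq_complex /=; apply/andP; split; apply/eqP; ring.
apply: le_trans (normC_le _ _) _; rewrite -rmorphM lecR.
have nx := normr_ge0 x; have ny := normr_ge0 y.
have he1 : `|expR x - 1 - x| <= `|x| by rewrite (le_trans he)// ler_piMl.
have ex3 : expR x <= 3.
  by have := ler_norm x; have := ler_norm (expR x - 1 - x); lra.
have ex1 : `|expR x - 1| <= 2 * s.
  have -> : expR x - 1 = (expR x - 1 - x) + x by ring.
  by rewrite (le_trans (ler_normD _ _))//; lra.
have ey : e1 * `|y| <= e1 * s by rewrite ler_pM2l.
have ex : e1 * `|x| <= e1 * s by rewrite ler_pM2l.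
have b1 : `|expR x * (cos y - 1)| <= 3 * (e1 * s).
  rewrite normrM (ger0_norm (expR_ge0 _)) ler_pM ?expR_ge0//; lra.
have b2 : `|expR x * (sin y - y)| <= 3 * (e1 * s).
  rewrite normrM (ger0_norm (expR_ge0 _)) ler_pM ?expR_ge0//; lra.
have b3 : `|y * (expR x - 1)| <= e1 * (2 * s).
  by rewrite normrM ler_pM//; lra.
have b4 := ler_normD (expR x - 1 - x) (expR x * (cos y - 1)).
have b5 := ler_normD (expR x * (sin y - y)) (y * (expR x - 1)).
have : 9 * e1 * s <= e * s by rewrite ler_wpM2r// (le_trans nx).
lra.
Qed.

Lemma is_derive_cexp (z : C) : is_derive z 1 (@cexp R : C -> C) (cexp z).
Proof.
apply/is_derive1P => -[e e']; rewrite ltcE /= => /andP[/eqP -> e0].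
pose m : R := complex.Re `|cexp z : C|.
have mE : `|cexp z : C| = m%:C by rewrite /m normc_def.
have m0 : 0 <= m by rewrite -ler0c -mE normr_ge0.
(* Dividing by [m + 1] requires only [0 <= m]. *)
have em0 : 0 < e / (m + 1) by rewrite divr_gt0// ltr_wpDl.
have [r r0 hr] := cexp_approx0 em0.
exists r%:C; first by rewrite ltcR.
move=> h /hr hh.
have -> : cexp (h + z) - cexp z - cexp z * h = cexp z * (cexp h - 1 - h).
  by rewrite cexpD; ring.
rewrite normrM mE; apply: le_trans (ler_wpM2l _ hh) _; first by rewrite ler0c.
rewrite mulrA ler_wpM2r// -rmorphM lecR mulrCA ler_piMr ?(ltW e0)//.
by rewrite ler_pdivrMr ?mul1r ?lerDl// ltr_wpDl.
Qed.

Lemma is_derive_cexpN (z : C) :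
  is_derive z 1 (fun w : C => cexp (- w)) (- cexp (- z)).
Proof.
apply/is_derive1P => e e0.
have [r r0 hr] := (is_derive1P _ _ _).1 (is_derive_cexp (- z)) e e0.
exists r => // h hlt; have := hr (- h); rewrite !normrN => /(_ hlt).
by rewrite -opprD mulrN mulNr.
Qed.

(** * Isotropic curves of linear images and of explicit real parts *)

Definition real_mx m n (A : 'M[R]_(m, n)) : 'M[C]_(m, n) :=
  map_mx (real_complex R) A.

(** [derive1] takes a default value where a slice is not derivable, so [isotropic_curve] commutes
    with linear maps only under this condition. *)
Definition sliceable X (z : C) := forall j,
  derivable (slice_re X z j) (complex.Re z) 1 /\
  derivable (slice_im X z j) (complex.Im z) 1.

Lemma isotropic_curve_mulmx (A : 'M[R]_3) X z : sliceable X z ->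
  sliceable (fun w => A *m X w) z /\
  isotropic_curve (fun w => A *m X w) z = real_mx A *m isotropic_curve X z.
Proof.
move=> dX.
have dre j : is_derive (complex.Re z) 1 (slice_re X z j)
    ((\col_k (slice_re X z k)^`()%classic (complex.Re z)) j 0).
  by rewrite mxE derive1E; split=> //; exact: (dX j).1.
have dim j : is_derive (complex.Im z) 1 (slice_im X z j)
    ((\col_k (slice_im X z k)^`()%classic (complex.Im z)) j 0).
  by rewrite mxE derive1E; split=> //; exact: (dX j).2.
have dre' := is_derive_mulmx A dre; have dim' := is_derive_mulmx A dim.
split=> [j|]; first by split; [case: (dre' j)|case: (dim' j)].
apply/colP => j; rewrite [LHS]mxE !derive1E.
rewrite (@derive_val _ _ _ _ _ _ _ (dre' j)) (@derive_val _ _ _ _ _ _ _ (dim' j)).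
rewrite !mxE -sumrN; apply/eqP; rewrite eq_complex !raddf_sum /=.
apply/andP; split; apply/eqP; apply: eq_bigr => k _; rewrite !mxE /=; ring.
Qed.

Definition catenoid_curve (z : C) : 'cV[C]_3 :=
  col3 (- 'i) ((cexp z + cexp (- z)) / 2) ((cexp z - cexp (- z)) / 2).

Definition catenoid_primitive (z : C) : 'cV[C]_3 :=
  col3 (- 'i * z) ((cexp z - cexp (- z)) / 2) ((cexp z + cexp (- z)) / 2).

(** An explicit primitive replaces the integral. Both surfaces to be constructed have this form: the
    dual with [M = D P_t], the Bonnet surface with [M = A0^T D]. *)
Definition goursat_catenoid M (z : C) : 'cV[R]_3 :=
  \col_j complex.Re ((M *m catenoid_primitive z) j 0).

Lemma is_derive_catenoid_primitive z k :
  is_derive z 1 (fun w => catenoid_primitive w k 0) (catenoid_curve z k 0).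
Proof.
have d := is_derive_cexp z; have dN := is_derive_cexpN z.
have -> : (fun w => catenoid_primitive w k 0) = [:: - 'i \*: (@id C);
  2^-1 \*: (@cexp R - (fun w : C => cexp (- w)));
  2^-1 \*: (@cexp R + (fun w : C => cexp (- w)))]`_k.
  apply/funext => w; rewrite /catenoid_primitive mxE.
  by case: k => -[|[|[|]]] //= _; rewrite /= mulrC.
rewrite /catenoid_curve mxE; move: k; apply: ord3_ind => /=.
- by apply: is_derive_eq (is_deriveZ _ _) _; rewrite -[_ *: _]/(_ * _) mulr1.
- apply: is_derive_eq (is_deriveZ _ (is_deriveB d dN)) _.
  by rewrite -[_ *: _]/(_ * _) mulrC opprK.
- apply: is_derive_eq (is_deriveZ _ (is_deriveD d dN)) _.
  by rewrite -[_ *: _]/(_ * _) mulrC.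
Qed.

(** If [X = Re F] with [F] holomorphic, then [X_x = Re F'] and [X_y = - Im F'], so
    [X_x - i X_y = F']. *)
Lemma isotropic_curve_goursat_catenoid M z :
  sliceable (goursat_catenoid M) z /\
  isotropic_curve (goursat_catenoid M) z = M *m catenoid_curve z.
Proof.
have d j := is_derive_mulmx M (is_derive_catenoid_primitive z) j.
have dre j : is_derive (complex.Re z) 1 (slice_re (goursat_catenoid M) z j)
    (complex.Re ((M *m catenoid_curve z) j 0)).
  have -> : slice_re (goursat_catenoid M) z j = (fun s : R =>
      complex.Re ((M *m catenoid_primitive (s +i* complex.Im z)) j 0)).
    by apply/funext => s; rewrite /slice_re mxE.
  exact: is_derive_re_slice (d j).
have dim j : is_derive (complex.Im z) 1 (slice_im (goursat_catenoid M) z j)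
    (- complex.Im ((M *m catenoid_curve z) j 0)).
  have -> : slice_im (goursat_catenoid M) z j = (fun s : R =>
      complex.Re ((M *m catenoid_primitive (complex.Re z +i* s)) j 0)).
    by apply/funext => s; rewrite /slice_im mxE.
  exact: is_derive_im_slice (d j).
split=> [j|]; first by split; [case: (dre j)|case: (dim j)].
apply/colP => j; rewrite [LHS]mxE !derive1E.
rewrite (@derive_val _ _ _ _ _ _ _ (dre j)) (@derive_val _ _ _ _ _ _ _ (dim j)).
by rewrite opprK; case: (_ j 0).
Qed.

Lemma holomorphic_mulmx_catenoid M j :
  holomorphic setT (fun z => (M *m catenoid_curve z) j 0).
Proof.
move=> z _; have d := is_derive_cexp z; have dN := is_derive_cexpN z.
(* Only derivability matters here, so the derivatives are left uncomputed. *)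
pose dcat : 'cV[C]_3 := \col_k 'D_1 (fun w : C => catenoid_curve w k 0) z.
suff dk k : is_derive z 1 (fun w => catenoid_curve w k 0) (dcat k 0).
  by case: (is_derive_mulmx M dk j).
rewrite mxE; split=> //.
have -> : (fun w => catenoid_curve w k 0) = [:: cst (- 'i);
  2^-1 \*: (@cexp R + (fun w : C => cexp (- w)));
  2^-1 \*: (@cexp R - (fun w : C => cexp (- w)))]`_k.
  apply/funext => w; rewrite /catenoid_curve mxE.
  by case: k => -[|[|[|]]] //= _; rewrite /= mulrC.
case: d dN => d _ [dN _]; move: k; apply: ord3_ind => /=.
- exact: derivable_cst.
- exact/derivableZ/derivableD.
- exact/derivableZ/derivableB.
Qed.

(** * Diagonal matrices and quadratic forms *)

Let D : 'M[C]_3 := diag3 'i 'i 1.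

Lemma trmx_diag3 (a b c : C) : (diag3 a b c)^T = diag3 a b c.
Proof. exact: tr_diag_mx. Qed.

Lemma mul_diag3 (a b c a' b' c' : C) :
  diag3 a b c *m diag3 a' b' c' = diag3 (a * a') (b * b') (c * c').
Proof.
rewrite /diag3 mulmx_diag; congr diag_mx; apply/rowP.
by apply: ord3_ind; rewrite !mxE.
Qed.

Lemma diag3_1 : diag3 1 1 1 = 1%:M :> 'M[C]_3.
Proof. by apply/matrixP => i j; rewrite !mxE; move: i; apply: ord3_ind. Qed.

Lemma oppr_diag3 (a b c : C) : - diag3 a b c = diag3 (- a) (- b) (- c).
Proof.
rewrite /diag3 -raddfN; congr diag_mx; apply/rowP.
by apply: ord3_ind; rewrite !mxE.
Qed.

(** Stated for any square root of [-1] because it serves both [D] and its inverse. *)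
Lemma sqr_diag3_imaginary (i : C) :
  i ^+ 2 = - 1 -> diag3 i i 1 *m diag3 i i 1 = - J C.
Proof. by move=> i2; rewrite mul_diag3 -expr2 i2 mulr1 oppr_diag3 opprK. Qed.

(** As a matrix product, the form evaluated at [M *m u] exposes [M^T *m _ *m M], where the isometry
    relations apply. *)
Definition gram (eps : C) (u : 'cV[C]_3) : C := (u^T *m diag3 1 1 eps *m u) 0 0.

Lemma gramE eps u : gram eps u = u 0 0 ^+ 2 + u 1 0 ^+ 2 + eps * u 2 0 ^+ 2.
Proof.
by rewrite /gram -mulmxA mul_diag_mx mxE sum_ord3 !mxE /=; ring.
Qed.

(** This is [cosh^2 - sinh^2 = 1], with [(-i)^2 = -1]. *)
Lemma gram_catenoid z : gram (- 1) (catenoid_curve z) = 0.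
Proof.
rewrite gramE !mxE /=; have ee := cexpxNx z.
have i2 : 'i ^+ 2 = -1 :> C by rewrite sqrCi.
by field: ee i2.
Qed.

(** * Recovering the catenoid curve from its Weierstrass data *)

Lemma holomorphic_eq_off_cexpN1 (f g : C -> C) :
  holomorphic setT f -> holomorphic setT g ->
  (forall z, cexp z != -1 -> f z = g z) -> f = g.
Proof.
move=> hf hg fg; apply/funext => z; apply/eqP; rewrite -subr_eq0.
have [eN1|/fg ->] := eqVneq (cexp z) (-1); last by rewrite subrr.
have hk : {for z, continuous (f - g)}.
  apply/differentiable_continuous/derivable1_diffP/derivableB.
  - exact: hf.
  - exact: hg.
apply/negPn/negP => k0.
have /cvgr_dist_lt/(_ `|f z - g z|) := hk; rewrite normr_gt0 => /(_ k0).
case=> -[r r'] /=; rewrite ltcE /= => /andP[/eqP -> r0] hr.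
(* A real shift by [r / 2] multiplies [cexp z = -1] by [expR (r / 2) > 1]: it leaves the exceptional
   set but stays in the ball given by continuity. *)
have := hr (z + (r / 2)%:C); rewrite /= opprD addNKr normrN normC_real ltcR.
have r20 : 0 < r / 2 by rewrite divr_gt0.
rewrite gtr0_norm// ltr_pdivrMr// ltr_pMr// ltr1n => /(_ isT).
suff -> : (f - g) (z + (r / 2)%:C) = 0 by rewrite subr0 ltxx.
apply/eqP; rewrite subr_eq0; apply/eqP/fg; rewrite cexpD eN1 mulN1r eqr_opp.
rewrite eq_complex /= cos0 mulr1 negb_and.
by rewrite gt_eqF// expR_gt1.
Qed.

(* Where [e^z = -1] the Weierstrass data vanish and do not determine the curve;
   there its value is recovered by continuity. *)
Lemma isotropic_curve_catenoid X : hyperbolic_catenoid X ->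
  isotropic_curve X = catenoid_curve.
Proof.
move=> [[_ _ hol iso _] W].
have hcat j : holomorphic setT (fun z => catenoid_curve z j 0).
  have := @holomorphic_mulmx_catenoid 1%:M j.
  by under eq_fun do rewrite mul1mx.
suff eqj j :
    (fun z => isotropic_curve X z j 0) = (fun z => catenoid_curve z j 0).
  by apply/funext => z; apply/colP => j; have /(congr1 (@^~ z)) := eqj j.
apply: holomorphic_eq_off_cexpN1 (hol j) (hcat j) _ => z eN1.
have [] := W z I; have := iso z I.
set p := isotropic_curve X z; move: (p) => {}p.
have e0 : cexp z != 0.
  by apply: contraTneq (oner_neq0 C) => z0; rewrite -(cexpxNx z) z0 mul0r eqxx.
have eN : cexp (- z) = (cexp z)^-1.
  by apply: (mulfI e0); rewrite cexpxNx mulfV.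
have e1 : cexp z + 1 != 0 by rewrite addr_eq0.
have i2 : 'i ^+ 2 = -1 :> C by rewrite sqrCi.
have i0 : 'i != 0 :> C by rewrite neq0Ci.
rewrite /catenoid_curve eN.
move: (cexp z) e0 e1 {eN1 eN} => e e0 e1 piso wE.
have w0 : - 'i * ((e + 1) ^+ 2 / (2 * e)) != 0 :> C.
  rewrite mulf_neq0 ?oppr_eq0// mulf_neq0 ?expf_neq0// invr_neq0//.
  by rewrite mulf_neq0// pnatr_eq0.
move=> /(_ w0) gE.
have p2E : p 2 0 = (e - e^-1) / 2.
  apply: (mulIf (invr_neq0 w0)); rewrite -gE; field: i2.
  by rewrite ?e0 ?e1 ?i0.
(* Isotropy factors as [(p0 - i p1) (p0 + i p1) = p2^2]. The first factor is the known nonzero [w],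
   so the second follows, then [p0] and [p1] by half sum and difference. *)
have p01 : p 0 0 + 'i * p 1 0 = 'i * ((e - 1) ^+ 2 / (2 * e)).
  apply: (mulfI w0); rewrite {1}wE.
  have -> : (p 0 0 - 'i * p 1 0) * (p 0 0 + 'i * p 1 0) = p 2 0 ^+ 2.
    move: piso; rewrite rmorphN1 mulN1r => /eqP; rewrite subr_eq0 => /eqP <-.
    by rewrite -subr_sqr exprMn i2 mulN1r opprK.
  by rewrite p2E; field: i2; rewrite e0.
have p0E : p 0 0 = - 'i.
  have -> : p 0 0 = ((p 0 0 - 'i * p 1 0) + (p 0 0 + 'i * p 1 0)) / 2 by field.
  by rewrite -wE p01; field; rewrite ?e0 ?i0.
have p1E : p 1 0 = (e + e^-1) / 2.
  have -> : p 1 0 = ((p 0 0 + 'i * p 1 0) - (p 0 0 - 'i * p 1 0)) / (2 * 'i).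
    by field.
  by rewrite -wE p01; field; rewrite ?e0 ?i0.
by move: j; apply: ord3_ind; rewrite mxE.
Qed.

(** * Surfaces built from the catenoid curve *)

(** The relation on [M] turns the Euclidean form on [M c] into minus the Lorentz form on [c], which
    vanishes. Simple connectedness of the plane is inherited from a given surface over [setT]. *)
Lemma minimal_surface_goursat_catenoid M :
  simply_connected_domain [set: C] -> M^T *m M = - J C ->
  minimal_surface setT (goursat_catenoid M).
Proof.
move=> scd MM.
have isoE z := (isotropic_curve_goursat_catenoid M z).2.
split=> //.
- by move=> z _; exact: (isotropic_curve_goursat_catenoid M z).1.
- move=> j; under [X in holomorphic _ X]eq_fun do rewrite isoE.
  exact: holomorphic_mulmx_catenoid.
- move=> z _; rewrite -gramE isoE /gram.
  rewrite rmorph1 diag3_1.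
  rewrite trmx_mul mulmx1 mulmxA -(mulmxA _ M^T) MM.
  by rewrite mulmxN mulNmx mxE [X in - X](gram_catenoid z) oppr0.
(* [M^T] maps [u] to [- J c(0)], whose first entry is ['i]; hence [u] is nonzero and its Hermitian
   norm does not vanish. *)
- exists 0 => //; rewrite isoE; set u := _ *m _.
  have : u != 0.
    apply/negP => /eqP u0; have := congr1 (mulmx M^T) u0.
    rewrite mulmxA MM mulmx0 mulNmx => /colP/(_ 0)/eqP.
    rewrite mul_diag_mx !mxE /=.
    by apply/negP; rewrite mul1r oppr_eq0 oppr_eq0 neq0Ci.
  apply: contraNneq => /eqP.
  have n2 i : 0 <= `|u i 0| ^+ 2 by rewrite exprn_ge0.
  rewrite rmorph1 mul1r !paddr_eq0 ?addr_ge0// !sqrf_eq0 !normr_eq0.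
  move=> /andP[/andP[/eqP u0 /eqP u1] /eqP u2]; apply/eqP/colP.
  by apply: ord3_ind; rewrite [RHS]mxE.
Qed.

(** The first identity gives maximality of the rotated catenoid and minimality of its dual; the
    second gives orthogonality of the Goursat matrix. *)
Lemma parabolic_rotation_J t :
  (parabolic_rotation t)^T *m J R *m parabolic_rotation t = J R /\
  parabolic_rotation t *m J R *m (parabolic_rotation t)^T = J R.
Proof.
by split; apply/matrixP; apply: ord3_ind; apply: ord3_ind;
  rewrite !mxE sum_ord3 mul_mx_diag !mxE /=; field.
Qed.

Lemma real_mx_parabolic_rotation_J t (P := real_mx (parabolic_rotation t)) :
  P^T *m J C *m P = J C /\ P *m J C *m P^T = J C.
Proof.
have JE : J C = real_mx (J R).
  rewrite /J /real_mx map_diag_mx; congr diag_mx; apply/rowP.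
  by apply: ord3_ind; rewrite !mxE /= ?rmorph1 ?rmorphN1.
have [PJ JP] := parabolic_rotation_J t.
by rewrite JE /P /real_mx map_trmx -!map_mxM PJ JP.
Qed.

Lemma maximal_surface_parabolic_rotation X t : hyperbolic_catenoid X ->
  maximal_surface setT (fun z => parabolic_rotation t *m X z).
Proof.
move=> hX; have [[scd dX _ _ _] _] := hX.
have dPX z := (isotropic_curve_mulmx (parabolic_rotation t) (dX z I)).1.
have isoE z : isotropic_curve (fun w => parabolic_rotation t *m X w) z =
    real_mx (parabolic_rotation t) *m catenoid_curve z.
  by rewrite (isotropic_curve_mulmx _ (dX z I)).2 isotropic_curve_catenoid.
split=> //.
- by move=> z _; exact: dPX.
- move=> j; under [X in holomorphic _ X]eq_fun do rewrite isoE.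
  exact: holomorphic_mulmx_catenoid.
- move=> z _; rewrite -gramE isoE /gram rmorphN1.
  have [PJ _] := real_mx_parabolic_rotation_J t.
  rewrite trmx_mul mulmxA -(mulmxA _ _^T) -(mulmxA _ (_^T *m _)) PJ.
  exact: gram_catenoid.
(* At [0] the catenoid curve is [(-i, 1, 0)]; after rotation its Hermitian Lorentz norm is 2
   whatever [t] is. *)
- exists 0 => //; rewrite isoE !mxE !sum_ord3 !mxE /= oppr0 cexp0.
  rewrite !(subrr, mul0r, mulr0, addr0).
  have -> : (1 + 1) / 2 = 1 :> C by field.
  have n2 (a b : R) : `|a%:C * - 'i + b%:C * 1 : C| ^+ 2 = (a ^+ 2 + b ^+ 2)%:C.
    by rewrite -add_Re2_Im2 /=; congr _%:C; ring.
  rewrite !n2 -rmorphM -!rmorphD (_ : _ + _ = 2); last by field.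
  by rewrite rmorph_nat pnatr_eq0.
Qed.

(* The matrix expressing [D c = (1, i cosh, sinh)] in terms of the isotropic
   curve [(-1 - e^z/2, i (1 + e^z/2 + e^-z), 1 + e^-z)] of [B(1)]. *)
Definition bonnet_frame : 'M[C]_3 := \matrix_(i < 3, j < 3)
  nth 0 (nth [::] [:: [:: - 1; 'i; 1];
                      [:: 'i / 2; 3 / 2; - 'i];
                      [:: - (1 / 2); - ('i / 2); - 1]] i) j.

Lemma bonnet_frame_orthogonal : bonnet_frame *m bonnet_frame^T = 1%:M.
Proof.
have i2 : 'i ^+ 2 = -1 :> C by rewrite sqrCi.
by apply/matrixP; apply: ord3_ind; apply: ord3_ind;
  rewrite !mxE sum_ord3 !mxE /=; field: i2.
Qed.

(** Minimality follows from [D A0 A0^T D = D^2 = - J]. The Weierstrass data are read off from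
    [w = e^-z] and [g w = 1 + e^-z]. *)
Lemma bonnet_model_goursat_catenoid :
  simply_connected_domain [set: C] ->
  bonnet_model 1 (goursat_catenoid (bonnet_frame^T *m D)).
Proof.
move=> scd; split.
  apply: minimal_surface_goursat_catenoid => //.
  rewrite trmx_mul trmxK trmx_diag3 mulmxA -(mulmxA D) bonnet_frame_orthogonal.
  by rewrite mulmx1 (sqr_diag3_imaginary (sqrCi _)).
move=> z _; rewrite (isotropic_curve_goursat_catenoid _ z).2 -mulmxA.
rewrite mul_diag_mx.
have i2 : 'i ^+ 2 = -1 :> C by rewrite sqrCi.
rewrite !mxE !sum_ord3 !mxE /=; have := cexpxNx z.
move: (cexp z) (cexp (- z)) => e e' ee.
split=> [|e'0]; first by field: i2.
by apply: (mulIf e'0); rewrite mulfVK// mulrDl ee; field: i2.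
Qed.

(** * The Goursat transformation *)

Lemma goursat_catenoid_of_bonnet P Y :
  minimal_surface setT Y -> P *m J C *m P^T = J C ->
  (forall z, isotropic_curve Y z = D *m P *m catenoid_curve z) ->
  goursat_of_bonnet setT Y.
Proof.
move=> Ymin PJ YE; have [scd _ _ _ _] := Ymin.
pose B := goursat_catenoid (bonnet_frame^T *m D).
have [Bmin BW] := bonnet_model_goursat_catenoid scd.
have refl S : similar_surfaces setT S setT S.
  exists id, 1, 1%:M, 0; split=> //.
  - by split=> [z _|z w _ _|z _] //=; exists z.
  - by rewrite trmx1 mulmx1 det1.
  - by move=> z _; rewrite mul1mx scale1r addr0.
exists setT, B, Y; split=> //.
  by split=> //; exists 1, B; split.
split=> //; pose D' : 'M[C]_3 := diag3 (- 'i) (- 'i) 1.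
have DD' : D' *m D = 1%:M.
  rewrite mul_diag3 mulNr -expr2 sqrCi opprK mulr1; exact: diag3_1.
have D'2 : D' *m D' = - J C.
  by apply: sqr_diag3_imaginary; rewrite sqrrN sqrCi.
have DJD : D *m J C *m D = - 1%:M.
  by rewrite mul_diag3 mul_diag3 !mulr1 mul1r -expr2 sqrCi -oppr_diag3 diag3_1.
(* With [D' = D^-1], this matrix [A] satisfies [A A^T = D P D'^2 P^T D = - D P J P^T D = - D J D =
   1]. *)
exists (D *m P *m D' *m bonnet_frame); split.
  rewrite !trmx_mul !trmx_diag3 !mulmxA -(mulmxA _ bonnet_frame).
  rewrite bonnet_frame_orthogonal mulmx1 -(mulmxA _ D' D') D'2.
  by rewrite mulmxN !mulNmx -!(mulmxA D) PJ mulmxA DJD opprK.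
move=> z _; rewrite (isotropic_curve_goursat_catenoid _ z).2 YE !mulmxA.
rewrite -(mulmxA _ bonnet_frame) bonnet_frame_orthogonal mulmx1.
by rewrite -(mulmxA _ D') DD' mulmx1.
Qed.

End ConformalSurfaces.

Theorem theorem5p3 (R : realType) (X : Cplx R -> 'cV[R]_3)
    (hX : hyperbolic_catenoid X) (t : R) :
  let PtX := fun z => parabolic_rotation t *m X z in
  (exists Y : Cplx R -> 'cV[R]_3, dual_surface setT PtX Y) /\
  (forall Y : Cplx R -> 'cV[R]_3,
     dual_surface setT PtX Y -> goursat_of_bonnet setT Y).
Proof.
move=> PtX; have PtXmax := maximal_surface_parabolic_rotation t hX.
have [[scd dX _ _ _] _] := hX.
have [PJ JP] := real_mx_parabolic_rotation_J t.
have PtXE z : isotropic_curve PtX z =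
    real_mx (parabolic_rotation t) *m catenoid_curve z.
  by rewrite (isotropic_curve_mulmx _ (dX z I)).2 isotropic_curve_catenoid.
split=> [|Y [_ Ymin YE]].
  (* Here [M^T M = P^T D^2 P = - P^T J P = - J], as minimality demands. *)
  exists (goursat_catenoid (diag3 'i 'i 1 *m real_mx (parabolic_rotation t))).
  split=> // [|z _].
    apply: minimal_surface_goursat_catenoid => //.
    rewrite trmx_mul trmx_diag3 mulmxA.
    rewrite -(mulmxA _ (diag3 _ _ _) (diag3 _ _ _)) (sqr_diag3_imaginary (sqrCi _)).
    by rewrite mulmxN mulNmx PJ.
  by rewrite (isotropic_curve_goursat_catenoid _ z).2 PtXE mulmxA.
apply: goursat_catenoid_of_bonnet Ymin JP _ => z.
by rewrite YE// PtXE mulmxA.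
Qed.
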